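(* Let $k\in\mathbb{Z}^{+}\setminus\{1\}$ and $n\in\mathbb{Z}^{+}$, and let $f_n$ be the $n$-fold nested floor function $f_n(x)=\lfloor x\lfloor x\lfloor\cdots\rfloor\rfloor\rfloor$ ($n$ times), i.e. $f_1(x)=\lfloor x\rfloor$ and $f_{m+1}(x)=\lfloor x\cdot f_m(x)\rfloor$ for $m\ge 1$. Then $$\lim_{x\to k^{-}} f_n(x)=\frac{1}{k-1}\Bigl[(k-2)\cdot k^{n}+1\Bigr].$$
   Context: For real $x$, $\lfloor x\rfloor$ is the greatest integer less than or equal to $x$. $\mathbb{Z}^{+}$ is the set of positive integers. The limit is the left-hand limit of the real function $f_n$ at $k$. *)

(* Defs.v *)
From HB Require Import structures.
From mathcomp Require Import all_boot all_order all_algebra.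
From mathcomp Require Import all_classical all_reals all_analysis.

Set Implicit Arguments.
Unset Strict Implicit.
Unset Printing Implicit Defensive.

Import Order.TTheory GRing.Theory Num.Theory.
Import numFieldNormedType.Exports.

Local Open Scope classical_set_scope.
Local Open Scope ring_scope.

(* Only n >= 1 is meaningful: by n.-1, the value at n = 0 is that at n = 1. *)
Definition nested_floor (R : realType) (n : nat) (x : R) : R :=
  iter n.-1 (fun y => (Num.floor (x * y))%:~R) (Num.floor x)%:~R.

Lemma nested_floor1 (R : realType) (x : R) :
  nested_floor 1 x = (Num.floor x)%:~R.
Proof. by []. Qed.

Lemma nested_floorS (R : realType) (m : nat) (x : R) : (1 <= m)%N ->
  nested_floor m.+1 x = (Num.floor (x * nested_floor m x))%:~R.
Proof. by case: m. Qed.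

(* Main.v *)
(* A positive integer c satisfies floor (x c) = k c - 1 for x just below k. So
   the values of f_n just below k obey c_1 = k - 1 and c_(m+1) = k c_m - 1 (they
   stay positive because k >= 2), and solving the recurrence gives the formula. *)

Require Import Defs.
From HB Require Import structures.
From mathcomp Require Import all_boot all_order all_algebra.
From mathcomp Require Import all_classical all_reals all_analysis.
From mathcomp Require Import ring zify.

Set Implicit Arguments.
Unset Strict Implicit.
Unset Printing Implicit Defensive.

Import Order.TTheory GRing.Theory Num.Theory.
Import numFieldNormedType.Exports.

Local Open Scope classical_set_scope.
Local Open Scope ring_scope.

(** For [a - 1/c <= x < a], multiplying by [c > 0] gives [a c - 1 <= x c < a c], which pins down the
    floor. *)
Lemma near_left_floorM (R : realType) (a c : int) : 0 < c ->
  \forall x \near (a%:~R : R)^'-, Num.floor (x * c%:~R) = a * c - 1.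
Proof.
move=> c_gt0; have c_gt0R : 0 < c%:~R :> R by rewrite ltr0z.
near=> x; apply: floor_def; rewrite subrK intrB !intrM.
have x_lt : x < a%:~R by near: x; exact: nbhs_left_lt.
have x_ge : a%:~R - c%:~R^-1 <= x.
  by near: x; apply: nbhs_left_ge; rewrite ltrBlDr ltrDl invr_gt0.
rewrite ltr_pM2r // x_lt andbT.
have := x_ge; rewrite -(ler_pM2r c_gt0R) mulrBl mulVf //; exact: lt0r_neq0.
Unshelve. all: by end_near. Qed.

(** The closed form is multiplied by [k - 1] to stay an identity of integers; [0 < c] is carried
    along because the induction step applies [near_left_floorM] to [c]. *)
Lemma near_left_nested_floor (R : realType) (k m : nat) : (1 < k)%N ->
  exists c : int, [/\ 0 < c, (k%:Z - 1) * c = (k%:Z - 2) * k%:Z ^+ m.+1 + 1 &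
    \forall x \near (k%:R : R)^'-, nested_floor m.+1 x = c%:~R].
Proof.
move=> k_gt1; elim: m => [|m [c [c_gt0 cE f_near]]].
  exists (k%:Z - 1); split; [lia | by rewrite expr1; ring |].
  (* The innermost floor is the case [c = 1], since [x = x * 1]. *)
  have := @near_left_floorM R k 1 isT; apply: filterS => x.
  by rewrite !mulr1 nested_floor1 => ->.
exists (k%:Z * c - 1); split; [nia | |].
  by rewrite exprS mulrBr mulrCA cE; ring.
have floor_near := @near_left_floorM R k c c_gt0.
by apply: filterS2 f_near floor_near => x fxE floorE; rewrite nested_floorS // fxE floorE.
Qed.

Theorem theorem1 (R : realType) (k n : nat)
    (hk0 : (0 < k)%N) (hk1 : k <> 1%N) (hn : (0 < n)%N) :
  nested_floor n x @[x --> (k%:R : R)^'-] -->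
    (1 / (k%:R - 1) * ((k%:R - 2) * k%:R ^+ n + 1) : R).
Proof.
have k_gt1 : (1 < k)%N by lia.
case: n hn => // m _.
have [c [_ cE f_near]] := @near_left_nested_floor R k m k_gt1.
have k1_neq0 : k%:R - 1 != 0 :> R by rewrite subr_eq0 pnatr_eq1; lia.
(* Casting [cE] to [R] and cancelling the nonzero [k - 1] identifies the claimed limit with the
   constant value [c]. *)
have -> : 1 / (k%:R - 1) * ((k%:R - 2) * k%:R ^+ m.+1 + 1) = c%:~R :> R.
  have /(congr1 (fun z : int => z%:~R : R)) := cE.
  rewrite !(rmorphM, rmorphB, rmorphD, rmorphXn) /= => <-.
  by rewrite mul1r mulKf.
by apply: cvg_near_cst; apply: filterS f_near => x ->.
Qed.
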